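(* Let $V$ be a finite-dimensional complex vector space and let $\mathbf{X} = (X_n)_{n=1}^\infty$ with $X_n \subset M_n(V)$ for $n \ge 1$. If $x \in M_n(V)$ belongs to the matrix convex hull of $\mathbf{X}$, then it is a matrix convex combination of points of $\mathbf{X}$ of length at most $n^2 (2 \dim(V) + 1)$.
   Context: $M_n(V) = M_n \otimes V$ is the space of $n\times n$ matrices over $V$; scalar matrices of suitable sizes multiply elements of $M_n(V)$ from the left and right. $M_{k,n}$ denotes the complex $k \times n$ matrices. A matrix convex combination of elements $x_i \in M_{n_i}(V)$, $1 \le i \le s$, is an expression $x = \sum_{i=1}^s \gamma_i^* x_i \gamma_i \in M_n(V)$ with $\gamma_i \in M_{n_i,n}$ and $\sum_{i=1}^s \gamma_i^*\gamma_i = I_n$; the integer $s$ is its length (some $x_i$ may be repeated, and repetitions count towards the length). $\mathbf{X}$ is matrix convex if it is closed under matrix convex combinations of its elements. The matrix convex hull of $\mathbf{X}$ is the smallest matrix convex set containing $\mathbf{X}$, equivalently the set of all matrix convex combinations of elements of $\mathbf{X}$. $\dim(V)$ is the complex dimension. *)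

(* Defs.v *)
From HB Require Import structures.
From mathcomp Require Import all_boot all_order all_algebra.
From mathcomp Require Import sesquilinear spectral.
From mathcomp Require Import classical_sets reals.
From mathcomp.real_closed Require Export complex.

Set Implicit Arguments.
Unset Strict Implicit.
Unset Printing Implicit Defensive.

Import GRing.Theory Num.Theory.

Local Open Scope ring_scope.
Local Open Scope sesquilinear_scope.
Local Open Scope classical_set_scope.

Section MatrixConvexity.
Variables (C : numClosedFieldType) (V : lmodType C).

Definition lmulmxV m n p (a : 'M[C]_(m, n)) (x : 'M[V]_(n, p)) : 'M[V]_(m, p) :=
  \matrix_(i, j) \sum_k a i k *: x k j.

Definition rmulmxV m n p (x : 'M[V]_(m, n)) (b : 'M[C]_(n, p)) : 'M[V]_(m, p) :=
  \matrix_(i, j) \sum_k b k j *: x i k.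

(* Matrix sizes are positive: [X n] is the set at level n.+1.  *)
Definition matrix_family : Type := forall n : nat, set 'M[V]_n.+1.

(* The size of the i-th point [y i] is (k i).+1; [a ^t*] is the conjugate
   transpose.  Repetitions among the [y i] are allowed and count in [s]. *)
Definition matrix_convex_combination_of
    (X : matrix_family) (s n : nat) (x : 'M[V]_n.+1) : Prop :=
  exists (k : 'I_s -> nat) (y : forall i, 'M[V]_((k i).+1))
         (g : forall i, 'M[C]_((k i).+1, n.+1)),
    [/\ forall i, X (k i) (y i),
        \sum_i (g i)^t* *m g i = 1%:M
      & x = \sum_i rmulmxV (lmulmxV ((g i)^t*) (y i)) (g i)].

Definition matrix_convex (X : matrix_family) : Prop :=
  forall s n (x : 'M[V]_n.+1), matrix_convex_combination_of X s x -> X n x.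

(* The smallest matrix convex family containing X, as an intersection. *)
Definition matrix_convex_hull (X : matrix_family) : matrix_family :=
  fun n => [set x | forall Y : matrix_family, matrix_convex Y ->
                      (forall m, X m `<=` Y m) -> Y n x].

End MatrixConvexity.

Arguments matrix_convex_hull {C V} X n _.

(* Main.v *)
(* The conic Caratheodory argument. The combination sum_i g_i^* y_i g_i
   corresponds to the sum of the pairs (g_i^* g_i, g_i^* y_i g_i), which live in
   the real vector space of (Hermitian N x N matrices) x M_N(V), of dimension
   N^2 + 2 N^2 dim V. With more terms than this there is a real linear relation
   with coefficients c_i, some c_i being positive. If c_0 > 0 is the largest one,
   replacing each g_i by sqrt(1 - c_i / c_0) g_i changes neither sum and kills
   one term. *)
Require Import Defs.
From mathcomp Require Import all_boot all_order all_algebra.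
From mathcomp Require Import sesquilinear spectral.
From mathcomp Require Import boolp classical_sets reals.
From mathcomp.real_closed Require Import complex.

Import Order.TTheory GRing.Theory Num.Theory.

Local Open Scope ring_scope.
Local Open Scope sesquilinear_scope.

(** * Left and right actions of scalar matrices on matrices over [V] *)

Section Bimodule.

Set Implicit Arguments.
Unset Strict Implicit.

Variables (C : numClosedFieldType) (V : lmodType C).

Lemma lmulmxVA m n p q (a : 'M[C]_(m, n)) (b : 'M[C]_(n, p)) (x : 'M[V]_(p, q)) :
  lmulmxV a (lmulmxV b x) = lmulmxV (a *m b) x.
Proof.
apply/matrixP => i j; rewrite !mxE.
under eq_bigr do rewrite mxE scaler_sumr.
rewrite exchange_big; apply: eq_bigr => l _ /=; rewrite mxE scaler_suml.
by apply: eq_bigr => k _; rewrite scalerA.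
Qed.

Lemma rmulmxVA m n p q (x : 'M[V]_(m, n)) (a : 'M[C]_(n, p)) (b : 'M[C]_(p, q)) :
  rmulmxV (rmulmxV x a) b = rmulmxV x (a *m b).
Proof.
apply/matrixP => i j; rewrite !mxE.
under eq_bigr do rewrite mxE scaler_sumr.
rewrite exchange_big; apply: eq_bigr => l _ /=; rewrite mxE scaler_suml.
by apply: eq_bigr => k _; rewrite scalerA mulrC.
Qed.

Lemma lrmulmxVA m n p q (a : 'M[C]_(m, n)) (x : 'M[V]_(n, p)) (b : 'M[C]_(p, q)) :
  lmulmxV a (rmulmxV x b) = rmulmxV (lmulmxV a x) b.
Proof.
apply/matrixP => i j; rewrite !mxE.
under eq_bigr do rewrite mxE scaler_sumr.
rewrite exchange_big; apply: eq_bigr => l _ /=; rewrite mxE scaler_sumr.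
by apply: eq_bigr => k _; rewrite !scalerA mulrC.
Qed.

Lemma lmulmxV_sumr (I : finType) m n p (a : 'M[C]_(m, n)) (x : I -> 'M[V]_(n, p)) :
  lmulmxV a (\sum_i x i) = \sum_i lmulmxV a (x i).
Proof.
apply/matrixP => i j; rewrite !mxE summxE.
under eq_bigr do rewrite summxE scaler_sumr.
by rewrite exchange_big; apply: eq_bigr => l _; rewrite mxE.
Qed.

Lemma rmulmxV_suml (I : finType) m n p (x : I -> 'M[V]_(m, n)) (b : 'M[C]_(n, p)) :
  rmulmxV (\sum_i x i) b = \sum_i rmulmxV (x i) b.
Proof.
apply/matrixP => i j; rewrite !mxE summxE.
under eq_bigr do rewrite summxE scaler_sumr.
by rewrite exchange_big; apply: eq_bigr => l _; rewrite mxE.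
Qed.

(** Entrywise, so that [c] scales an element of [V] rather than a matrix over [V]. *)
Lemma lmulmxVZ m n p (c : C) (a : 'M[C]_(m, n)) (x : 'M[V]_(n, p)) i j :
  lmulmxV (c *: a) x i j = c *: lmulmxV a x i j.
Proof.
by rewrite !mxE scaler_sumr; apply: eq_bigr => k _; rewrite mxE scalerA.
Qed.

Lemma rmulmxVZ m n p q (c d : C) (a : 'M[C]_(m, n)) (x : 'M[V]_(n, p))
    (b : 'M[C]_(p, q)) i j :
  rmulmxV (lmulmxV (c *: a) x) (d *: b) i j
  = (c * d) *: rmulmxV (lmulmxV a x) b i j.
Proof.
rewrite !mxE scaler_sumr; apply: eq_bigr => k _.
by rewrite lmulmxVZ mxE !scalerA mulrC mulrA.
Qed.

Lemma trmxCM m n p (a : 'M[C]_(m, n)) (b : 'M[C]_(n, p)) :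
  (a *m b)^t* = b^t* *m a^t*.
Proof. by rewrite trmx_mul map_mxM. Qed.

Lemma mulmx1V n p (x : 'M[V]_(n, p)) : lmulmxV 1%:M x = x.
Proof.
apply/matrixP => i j; rewrite !mxE (bigD1 i) //= mxE eqxx scale1r big1 ?addr0 //.
by move=> k ki; rewrite mxE eq_sym (negbTE ki) scale0r.
Qed.

Lemma mulmxV1 n p (x : 'M[V]_(n, p)) : rmulmxV x 1%:M = x.
Proof.
apply/matrixP => i j; rewrite !mxE (bigD1 j) //= mxE eqxx scale1r big1 ?addr0 //.
by move=> k ki; rewrite mxE (negbTE ki) scale0r.
Qed.

Lemma trmxC1 n : (1%:M : 'M[C]_n)^t* = 1%:M.
Proof. by rewrite trmx1 map_mx1. Qed.

(** * The hull as the set of all matrix convex combinations *)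

Lemma matrix_convex_combination_fin (X : matrix_family V) (I : finType) n
    (x : 'M[V]_n.+1) (k : I -> nat) (y : forall i, 'M[V]_((k i).+1))
    (g : forall i, 'M[C]_((k i).+1, n.+1)) :
    (forall i, X (k i) (y i)) ->
    \sum_i (g i)^t* *m g i = 1%:M ->
    x = \sum_i rmulmxV (lmulmxV ((g i)^t*) (y i)) (g i) ->
  matrix_convex_combination_of X #|I| x.
Proof.
move=> Xy g1 ->.
exists (fun i => k (enum_val i)), (fun i => y (enum_val i)).
exists (fun i => g (enum_val i)); split=> //.
- rewrite -g1 -(big_enum_val (fun i => (g i)^t* *m g i)).
  by apply: eq_bigl.
- rewrite -(big_enum_val (fun i => rmulmxV (lmulmxV ((g i)^t*) (y i)) (g i))).
  by apply: eq_bigl.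
Qed.

(** Substituting [y i], a combination of the [z i j] with coefficients [h i j], into a combination
    with coefficients [g i] gives a combination indexed by the pairs [(i, j)], with coefficients
    [h i j *m g i]. *)
Lemma matrix_convex_combinations_convex (X : matrix_family V) :
  matrix_convex
    (fun n => [set x : 'M[V]_n.+1 |
                 exists s, matrix_convex_combination_of X s x]%classic).
Proof.
move=> s n x [k] [y] [g] [Xy g1 ->] /=.
(* Classical choice turns the existence statements into data depending on [i]; nested sigma types
   are used because each component's type depends on the earlier ones. *)
have {Xy} Xy i : {t : nat & {l : 'I_t -> nat & {z : forall j, 'M[V]_((l j).+1) &
    {h : forall j, 'M[C]_((l j).+1, (k i).+1) |
    [/\ forall j, X (l j) (z j), \sum_j (h j)^t* *m h j = 1%:M
      & y i = \sum_j rmulmxV (lmulmxV ((h j)^t*) (z j)) (h j)]}}}}.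
  have /cid[t /cid[l /cid[z /cid[h H]]]] := Xy i.
  by exists t, l, z, h.
pose t i := projT1 (Xy i).
pose l i : 'I_(t i) -> nat := projT1 (projT2 (Xy i)).
pose z i : forall j, 'M[V]_((l i j).+1) := projT1 (projT2 (projT2 (Xy i))).
pose h i : forall j, 'M[C]_((l i j).+1, (k i).+1) :=
  proj1_sig (projT2 (projT2 (projT2 (Xy i)))).
have H i : [/\ forall j, X (l i j) (z i j), \sum_j (h i j)^t* *m h i j = 1%:M
      & y i = \sum_j rmulmxV (lmulmxV ((h i j)^t*) (z i j)) (h i j)].
  exact: proj2_sig (projT2 (projT2 (projT2 (Xy i)))).
exists #|{: {i : 'I_s & 'I_(t i)}}|.
apply: (@matrix_convex_combination_fin X {i : 'I_s & 'I_(t i)} _ _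
  (fun p => l (tag p) (tagged p)) (fun p => z (tag p) (tagged p))
  (fun p => h (tag p) (tagged p) *m g (tag p))).
- by move=> p; case: (H (tag p)).
(* The identity between [(g i)^t*] and [g i] is expanded as the sum of the [(h i j)^t* *m h i j]. *)
- rewrite -g1; under [RHS]eq_bigr => i _.
    have [_ h1 _] := H i.
    rewrite -{2}[g i]mul1mx -h1 mulmx_suml mulmx_sumr.
    over.
  rewrite sig_big_dep /=; apply: eq_bigr => p _.
  by rewrite trmxCM !mulmxA.
- under eq_bigr => i _.
    have [_ _ yE] := H i.
    rewrite yE lmulmxV_sumr rmulmxV_suml.
    over.
  rewrite sig_big_dep /=; apply: eq_bigr => p _.
  by rewrite trmxCM lrmulmxVA rmulmxVA lmulmxVA.
Qed.

Lemma matrix_convex_hull_combination (X : matrix_family V) n (x : 'M[V]_n.+1) :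
  matrix_convex_hull X n x -> exists s, matrix_convex_combination_of X s x.
Proof.
move=> hx; apply: (hx _ (@matrix_convex_combinations_convex X)).
(* A point of [X] is a combination of length 1 with identity coefficient. *)
move=> m y Xy; exists 1%N, (fun=> m), (fun=> y), (fun=> 1%:M).
by rewrite !big_ord1 trmxC1 mulmx1 mulmx1V mulmxV1.
Qed.

End Bimodule.

(** * Linear relations among more vectors than coordinates *)

(** The matrix with rows [f i] has rank at most [#|K|], hence a nonzero left kernel, whose vectors
    are the relations. *)
Lemma exists_linear_dependence (R : fieldType) (I K : finType) (f : I -> K -> R) :
    (#|K| < #|I|)%N ->
  exists2 c : I -> R, exists i, c i != 0 & forall k, \sum_i c i * f i k = 0.
Proof.
move=> KI; pose A := \matrix_(i < #|I|, k < #|K|) f (enum_val i) (enum_val k).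
have : kermx A != 0.
  rewrite -mxrank_eq0 mxrank_ker -lt0n subn_gt0.
  exact: leq_ltn_trans (rank_leq_col A) KI.
move=> /rowV0Pn[u /sub_kermxP uA u0].
exists (fun i => u 0 (enum_rank i)).
  have /existsP[j uj] : [exists j, u 0 j != 0].
    apply: contraNT u0; rewrite negb_exists => /forallP u0.
    by apply/eqP/rowP => j; rewrite mxE; apply/eqP; rewrite -[_ == _]negbK.
  by exists (enum_val j); rewrite enum_valK.
move=> k; move/rowP/(_ (enum_rank k)): uA; rewrite !mxE => uAk.
rewrite -[RHS]uAk (reindex (@enum_val I I)) /=; last first.
  exact: onW_bij (enum_val_bij I).
by apply: eq_bigr => i _; rewrite enum_valK mxE enum_rankK.
Qed.

(** * Real coordinates and removal of one term *)

Section Reduction.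

Set Implicit Arguments.
Unset Strict Implicit.

Variables (R : realType) (V : vectType R[i]).
Implicit Types X : matrix_family V.

Lemma ReMl (a : R) (z : R[i]) : complex.Re (a%:C%C * z) = a * complex.Re z.
Proof. by case: z => u v /=; rewrite mul0r subr0. Qed.

Lemma ImMl (a : R) (z : R[i]) : complex.Im (a%:C%C * z) = a * complex.Im z.
Proof. by case: z => u v /=; rewrite mul0r addr0. Qed.

Lemma Re_sum (I : finType) (z : I -> R[i]) :
  complex.Re (\sum_i z i) = \sum_i complex.Re (z i).
Proof. by elim/big_rec2: _ => // i u v _ <-; case: (z i) v => a b [c d]. Qed.

Lemma Im_sum (I : finType) (z : I -> R[i]) :
  complex.Im (\sum_i z i) = \sum_i complex.Im (z i).
Proof. by elim/big_rec2: _ => // i u v _ <-; case: (z i) v => a b [c d]. Qed.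

(* [Re H + Im H] determines a Hermitian [H]: its symmetric part is [Re H], its
   antisymmetric part [Im H]. *)
Lemma hermitian_eq0 n (H : 'M[R[i]]_n) :
    H^t* = H -> (forall i j, complex.Re (H i j) + complex.Im (H i j) = 0) ->
  H = 0.
Proof.
move=> hH H0; apply/matrixP => i j; rewrite mxE.
have E : H i j = (H j i)^*%C by rewrite -{1}hH !mxE.
have := H0 i j; have := H0 j i; rewrite E; case: (H j i) => u v /= uv uNv.
have v0 : v = 0.
  have : v *+ 2 = 0.
    rewrite mulr2n -[RHS](subrr 0) -{1}uv -uNv.
    by rewrite opprD opprK addrACA subrr add0r.
  by move/eqP; rewrite mulrn_eq0 => /eqP.
by move: uv; rewrite v0 addr0 oppr0 => ->.
Qed.

Lemma matrix_convex_combination_reduce X s n (x : 'M[V]_n.+1) :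
    (n.+1 ^ 2 * (2 * \dim {:V} + 1) < s.+1)%N ->
    matrix_convex_combination_of X s.+1 x ->
  matrix_convex_combination_of X s x.
Proof.
move=> sN [k] [y] [g] [Xy g1 xE].
pose P i := (g i)^t* *m g i.
pose Q i := rmulmxV (lmulmxV ((g i)^t*) (y i)) (g i).
(* Real coordinates of the pair [(P i, Q i)]: for each matrix position, one for the Hermitian [P i],
   and the real and imaginary parts of the [\dim {:V}] coordinates of the entry of [Q i]. This makes
   [n.+1 ^ 2 * (2 * \dim {:V} + 1)] in all. *)
pose f (i : 'I_s.+1)
    (e : ('I_n.+1 * 'I_n.+1) * option (bool * 'I_(\dim {:V}))) : R :=
  match e.2 with
  | None => complex.Re (P i e.1.1 e.1.2) + complex.Im (P i e.1.1 e.1.2)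
  | Some (b, l) => (if b then @complex.Re R else @complex.Im R)
                     (coord (vbasis {:V}) l (Q i e.1.1 e.1.2))
  end.
have [|c0 [i1 c0i1] c0f] := @exists_linear_dependence R _ _ f.
  rewrite card_prod card_option !card_prod card_bool !card_ord.
  by rewrite mulnn -[(2 * _).+1]addn1.
have [c [i0 [ci0 cmax]] cf] : exists2 c : 'I_s.+1 -> R,
    exists i0, 0 < c i0 /\ forall i, c i <= c i0
    & forall e, \sum_i c i * f i e = 0.
  (* Negating the relation if necessary makes its nonzero coefficient positive; the maximal one is
     then positive too. *)
  wlog ci1 : c0 c0i1 c0f / 0 < c0 i1.
    move=> W; case: (ltrgtP (c0 i1) 0) => [ci1|ci1|/eqP].
    - apply: (W (fun i => - c0 i)); rewrite ?oppr_eq0 ?oppr_gt0// => e.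
      by under eq_bigr do rewrite mulNr; rewrite sumrN c0f oppr0.
    - exact: W c0i1 c0f ci1.
    - by rewrite (negbTE c0i1).
  exists c0 => //; pose i0 := [arg max_(i > i1) c0 i]%O.
  exists i0; rewrite /i0; case: arg_maxP => // i _ imax; split.
    exact: lt_le_trans ci1 (imax _ isT).
  by move=> j; exact: imax.
(* A combination of Hermitian matrices with real coefficients is Hermitian, so [hermitian_eq0]
   applies. *)
have cP : \sum_i (c i)%:C%C *: P i = 0.
  apply: hermitian_eq0.
    rewrite linear_sum /= raddf_sum /=; apply: eq_bigr => i _.
    rewrite linearZ /= map_mxZ /= trmxCM.
    have -> : ((g i)^t*)^t* = g i by rewrite trmxCK.
    by congr (_ *: _); exact: conjc_real.
  move=> i j; rewrite summxE Re_sum Im_sum -big_split /= -[RHS](cf ((i, j), None)).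
  by apply: eq_bigr => l _; rewrite mxE ReMl ImMl -mulrDr.
have cQ i j : \sum_l (c l)%:C%C *: Q l i j = 0.
  rewrite (coord_vbasis (memvf (\sum_l _))) big1 // => m _.
  rewrite -[RHS](scale0r (vbasis {:V})`_m); congr (_ *: _).
  apply/eqP; rewrite linear_sum eq_complex; apply/andP; split; apply/eqP.
    rewrite Re_sum -[RHS](cf ((i, j), Some (true, m))).
    by apply: eq_bigr => l _; rewrite linearZ ReMl.
  rewrite Im_sum -[RHS](cf ((i, j), Some (false, m))).
  by apply: eq_bigr => l _; rewrite linearZ ImMl.
pose w i := 1 - c i / c i0.
(* Maximality of [c i0 > 0] gives [c i / c i0 <= 1], so [w i] has a real square root. *)
have w_ge0 i : 0 <= w i by rewrite subr_ge0 ler_pdivrMr// mul1r.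
have wi0 : w i0 = 0 by rewrite /w divff ?subrr// gt_eqF.
have wE i : (Num.sqrt (w i))%:C%C * (Num.sqrt (w i))%:C%C
    = 1 - (c i0)^-1%:C%C * (c i)%:C%C :> R[i].
  by rewrite -!rmorphM /= -expr2 sqr_sqrtr// rmorphB rmorph1 mulrC.
have gw (j : 'I_s) (i := lift i0 j) :
    ((Num.sqrt (w i))%:C%C *: g i)^t* = (Num.sqrt (w i))%:C%C *: (g i)^t*.
  by rewrite linearZ /= map_mxZ; congr (_ *: _); exact: conjc_real.
exists (fun j => k (lift i0 j)), (fun j => y (lift i0 j)).
exists (fun j => (Num.sqrt (w (lift i0 j)))%:C%C *: g (lift i0 j)); split=> //.
(* As [w i0 = 0], the sum over the indices [lift i0 j] equals the weighted sum over all indices; the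
   part of the weights proportional to [c] then vanishes by [cP]. *)
- transitivity (\sum_i ((Num.sqrt (w i))%:C%C * (Num.sqrt (w i))%:C%C) *: P i).
    rewrite (bigD1_ord i0) //= wi0 sqrtr0 mul0r scale0r add0r.
    by apply: eq_bigr => j _; rewrite gw -scalemxAl -scalemxAr scalerA.
  under eq_bigr do rewrite wE scalerBl scale1r -scalerA.
  by rewrite sumrB -scaler_sumr cP scaler0 subr0.
- apply/matrixP => i j; rewrite xE !summxE.
  transitivity (\sum_l ((Num.sqrt (w l))%:C%C * (Num.sqrt (w l))%:C%C)
                 *: Q l i j).
    under [RHS]eq_bigr do rewrite wE scalerBl scale1r -scalerA.
    by rewrite sumrB -scaler_sumr cQ scaler0 subr0.
  rewrite (bigD1_ord i0) //= wi0 sqrtr0 mul0r scale0r add0r.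
  by apply: eq_bigr => l _; rewrite gw rmulmxVZ.
Qed.

End Reduction.

Theorem theorem1p8 (R : realType) (V : vectType R[i])
    (X : matrix_family V) (n : nat) (x : 'M[V]_n.+1)
    (hx : matrix_convex_hull X n x) :
  exists s : nat,
    (s <= n.+1 ^ 2 * (2 * \dim {:V} + 1))%N /\
    matrix_convex_combination_of X s x.
Proof.
have [s] := matrix_convex_hull_combination hx.
(* Terms are dropped one at a time until the length meets the bound; length 0 meets it trivially. *)
elim: s => [|s IHs] xs; first by exists 0%N.
have [sN|sN] := leqP s.+1 (n.+1 ^ 2 * (2 * \dim {:V} + 1))%N.
  by exists s.+1.
exact/IHs/matrix_convex_combination_reduce.
Qed.
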